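(* For complex $a$ with $\operatorname{Re} a<0$ let $u(a)={}_3F_2\left(a,a+\tfrac13,a+\tfrac23;\tfrac13,\tfrac23;1\right)$. Then $u$ satisfies the differential equation $$u''(a)+3(\ln 3)\,u'(a)+\frac14\left(\pi^2+(\ln 27)^2\right)u(a)=0$$ for all $a$ with $\operatorname{Re} a<0$.
   Context: $(a)_n=\Gamma(a+n)/\Gamma(a)=a(a+1)\cdots(a+n-1)$ (with $(a)_0=1$) is the Pochhammer symbol, and ${}_3F_2(a,b,c;d,e;1)=\sum_{j=0}^\infty \frac{(a)_j(b)_j(c)_j}{(d)_j(e)_j\,j!}$, which converges when $\operatorname{Re}(d+e-a-b-c)>0$. *)

(* Defs.v *)
From Stdlib Require Import Reals Factorial.
From Coquelicot Require Import Coquelicot.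

Open Scope C_scope.

(* The product form is used rather than Gamma(a+n)/Gamma(a), since it also
   makes sense at the poles of Gamma. *)
Fixpoint pochhammer (a : C) (n : nat) : C :=
  match n with
  | O => 1
  | S k => pochhammer a k * (a + INR k)
  end.

(* Coquelicot's [Series] is real-valued only. A complex series converges iff
   its real and imaginary parts do; as with [Series], the value is meaningful
   only when [ex_series s] holds. *)
Definition CSeries (s : nat -> C) : C :=
  (Series (fun n => Re (s n)), Series (fun n => Im (s n))).

Definition hyp3F2_term (a b c d e z : C) (j : nat) : C :=
  (pochhammer a j * pochhammer b j * pochhammer c j)
  / (pochhammer d j * pochhammer e j * INR (fact j)) * Cpow z j.

Definition hyp3F2 (a b c d e z : C) : C := CSeries (hyp3F2_term a b c d e z).

Definition u (a : C) : C :=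
  hyp3F2 a (a + (1 / 3)%R) (a + (2 / 3)%R) (1 / 3)%R (2 / 3)%R 1.

(* Guards the meaning of [CSeries]. *)
Lemma CSeries_unique (s : nat -> C) (l : C) : is_series s l -> CSeries s = l.
Proof.
  intros H.
  assert (E : forall n, sum_n s n
     = (sum_n (fun k => Re (s k)) n, sum_n (fun k => Im (s k)) n)).
  { induction n as [|n IH].
    - rewrite !sum_O. apply surjective_pairing.
    - rewrite !sum_Sn, IH. reflexivity. }
  unfold CSeries. rewrite (surjective_pairing l). f_equal;
    apply is_series_unique; intros P [eps HP];
    destruct (H (fun z => ball l eps z) (locally_ball l eps)) as [N HN];
    exists N; intros n Hn; apply HP; specialize (HN n Hn);
    rewrite E in HN; apply HN.
Qed.

(* Main.v *)
(** With [(a)_j (a+1/3)_j (a+2/3)_j = (3a)_(3j) / 27^j] the series becomes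
    [u(a) = sum_j (3a)_(3j) / (3j)!], the part of the binomial series
    [sum_n (3a)_n / n! z^n = (1 - z)^(-3a)] at [z = 1] with indices divisible by 3.
    Averaging over the cube roots of unity [w] gives
    [u(a) = 1/3 sum_w (1 - w)^(-3a)]; the term [w = 1] vanishes because [Re a < 0],
    and [1 - w = sqrt 3 * exp (-+ i PI / 6)] for the other two. Hence
    [u(a) = 1/3 (exp (k1 a) + exp (k2 a))] with [k1, k2 = - 3/2 ln 3 +- i PI / 2],
    the roots of the characteristic polynomial of the equation.
    On the unit circle the binomial series converges absolutely by Raabe's test, and
    its value is obtained by Abel's theorem from the radial closed form. *)

Require Import Defs.
From Stdlib Require Import Reals Factorial Lra Lia.
From Coquelicot Require Import Coquelicot.
Open Scope C_scope.

(** * The complex exponential *)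

Definition Cexp (z : C) : C :=
  (exp (Re z) * cos (Im z), exp (Re z) * sin (Im z))%R.

Lemma Cexp_0 : Cexp 0 = 1.
Proof.
  unfold Cexp; simpl. rewrite exp_0, cos_0, sin_0.
  apply injective_projections; simpl; ring.
Qed.

Lemma Cexp_plus (z1 z2 : C) : Cexp (z1 + z2) = Cexp z1 * Cexp z2.
Proof.
  destruct z1 as [x1 y1], z2 as [x2 y2]. unfold Cexp; simpl.
  rewrite exp_plus, cos_plus, sin_plus.
  apply injective_projections; simpl; ring.
Qed.

Lemma Rabs_Cexp_le (z : C) :
  (Rabs (Re (Cexp z)) <= exp (Re z) /\ Rabs (Im (Cexp z)) <= exp (Re z))%R.
Proof.
  unfold Cexp; simpl. rewrite !Rabs_mult, (Rabs_pos_eq (exp _)) by (left; apply exp_pos).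
  assert (P := exp_pos (Re z)).
  assert (A : (Rabs (cos (Im z)) <= 1)%R) by apply Rabs_le, COS_bound.
  assert (B : (Rabs (sin (Im z)) <= 1)%R) by apply Rabs_le, SIN_bound.
  split; nra.
Qed.

Lemma Cmod_le_Rabs_plus (x y : R) : (Cmod (x, y) <= Rabs x + Rabs y)%R.
Proof.
  replace (x, y) with (RtoC x + Ci * RtoC y)
    by (apply injective_projections; simpl; ring).
  eapply Rle_trans; [apply Cmod_triangle|].
  rewrite Cmod_mult, Cmod_Ci, !Cmod_R. lra.
Qed.

Lemma is_derive_remainder_0 (f : R -> R) (l : R) :
  is_derive f 0%R l ->
  forall e : R, (0 < e)%R -> exists d : R, (0 < d)%R /\
    forall x, (Rabs x < d)%R -> (Rabs (f x - f 0 - x * l) <= e * Rabs x)%R.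
Proof.
  intros [_ H] e He.
  destruct (H 0%R (fun P HP => HP) (mkposreal e He)) as [d Hd].
  exists d; split; [apply cond_pos|]. intros x Hx.
  assert (B : ball 0%R d x).
  { unfold ball; simpl; unfold AbsRing_ball, abs, minus, plus, opp; simpl.
    now replace (x + - 0)%R with x by ring. }
  specialize (Hd x B). unfold norm in Hd; simpl in Hd.
  unfold abs, minus, plus, opp, scal in Hd; simpl in Hd; unfold mult in Hd; simpl in Hd.
  replace (x + - 0)%R with x in Hd by ring. exact Hd.
Qed.

(** Complex differentiability at 0 follows from the first-order expansions of the real [exp], [cos]
    and [sin]; [Cexp_plus] then carries it to every point. *)
Lemma Cexp_remainder_0 (e : R) : (0 < e)%R ->
  exists d : R, (0 < d)%R /\
    forall h : C, (Cmod h < d)%R -> (Cmod (Cexp h - 1 - h) <= e * Cmod h)%R.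
Proof.
  (* The final bound is [e' * Rabs x + (3 + 3 + 1) * e' * Rabs y], at most [8 * e' * m]. *)
  intros He. set (e' := (e / 8)%R). assert (He' : (0 < e')%R) by (unfold e'; lra).
  destruct (is_derive_remainder_0 exp 1) with (e := e') as [d1 [Hd1 H1]]; auto.
  { auto_derive; auto. rewrite exp_0; ring. }
  destruct (is_derive_remainder_0 cos 0) with (e := e') as [d2 [Hd2 H2]]; auto.
  { auto_derive; auto. rewrite sin_0; ring. }
  destruct (is_derive_remainder_0 sin 1) with (e := e') as [d3 [Hd3 H3]]; auto.
  { auto_derive; auto. rewrite cos_0; ring. }
  (* Solves [(1 + e') * d4 = e'], which makes [Rabs (exp x - 1) <= e']. *)
  set (d4 := (e' / (1 + e'))%R).
  assert (Hd4 : (0 < d4)%R) by (apply Rdiv_lt_0_compat; lra).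
  exists (Rmin (Rmin d1 d2) (Rmin (Rmin d3 d4) 1)). split.
  { repeat apply Rmin_glb_lt; lra. }
  intros [x y] Hh.
  apply Rmin_Rgt_l in Hh as [Ha Hb]. apply Rmin_Rgt_l in Ha as [Ha1 Ha2].
  apply Rmin_Rgt_l in Hb as [Hb Hb1]. apply Rmin_Rgt_l in Hb as [Hb3 Hb4].
  pose proof (Rmax_Cmod (x, y)) as HM. simpl in HM.
  pose proof (Rmax_l (Rabs x) (Rabs y)). pose proof (Rmax_r (Rabs x) (Rabs y)).
  set (m := Cmod (x, y)) in *.
  assert (Hx : (Rabs x <= m)%R) by lra. assert (Hy : (Rabs y <= m)%R) by lra.
  specialize (H1 x ltac:(lra)). specialize (H2 y ltac:(lra)). specialize (H3 y ltac:(lra)).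
  rewrite exp_0 in H1. rewrite cos_0 in H2. rewrite sin_0 in H3.
  assert (E3 : (0 < exp x <= 3)%R).
  { split; [apply exp_pos|]. apply Rle_trans with (exp 1); [|apply exp_le_3].
    left; apply exp_increasing. pose proof (Rle_abs x). lra. }
  assert (E1 : (Rabs (exp x - 1) <= e')%R).
  { replace (exp x - 1)%R with ((exp x - 1 - x * 1) + x)%R by ring.
    eapply Rle_trans; [apply Rabs_triang|].
    assert ((1 + e') * Rabs x <= (1 + e') * d4)%R by (apply Rmult_le_compat_l; lra).
    replace ((1 + e') * d4)%R with e' in H4 by (unfold d4; field; lra). lra. }
  change (Cexp (x, y) - 1 - (x, y))
    with ((exp x * cos y + - 1 + - x)%R, (exp x * sin y + - 0 + - y)%R).
  eapply Rle_trans; [apply Cmod_le_Rabs_plus|].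
  replace (exp x * cos y + - 1 + - x)%R
    with ((exp x - 1 - x * 1) + exp x * (cos y - 1 - y * 0))%R by ring.
  replace (exp x * sin y + - 0 + - y)%R
    with (exp x * (sin y - 0 - y * 1) + (exp x - 1) * y)%R by ring.
  assert (T1 := Rabs_triang (exp x - 1 - x * 1) (exp x * (cos y - 1 - y * 0))).
  assert (T2 := Rabs_triang (exp x * (sin y - 0 - y * 1)) ((exp x - 1) * y)).
  rewrite Rabs_mult, (Rabs_pos_eq (exp x)) in T1 by lra.
  rewrite !Rabs_mult, (Rabs_pos_eq (exp x)) in T2 by lra.
  assert (B1 : (exp x * Rabs (cos y - 1 - y * 0) <= 3 * (e' * Rabs y))%R)
    by (apply Rmult_le_compat; try lra; apply Rabs_pos).
  assert (B2 : (exp x * Rabs (sin y - 0 - y * 1) <= 3 * (e' * Rabs y))%R)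
    by (apply Rmult_le_compat; try lra; apply Rabs_pos).
  assert (B3 : (Rabs (exp x - 1) * Rabs y <= e' * Rabs y)%R)
    by (apply Rmult_le_compat_r; [apply Rabs_pos|lra]).
  assert (B4 : (e' * Rabs y <= e' * m)%R) by (apply Rmult_le_compat_l; lra).
  assert (B5 : (e' * Rabs x <= e' * m)%R) by (apply Rmult_le_compat_l; lra).
  replace (e * m)%R with (8 * (e' * m))%R by (unfold e'; field). lra.
Qed.

Lemma is_derive_Cexp (z : C) :
  is_derive (K := C_AbsRing) (V := C_NormedModule) Cexp z (Cexp z).
Proof.
  split; [apply is_linear_scal_l|].
  intros z' Hz'. apply (is_filter_lim_locally_unique (V := AbsRing_NormedModule C_AbsRing)) in Hz'. subst z'.
  intros e.
  set (M := Cmod (Cexp z)).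
  assert (HM : (0 <= M)%R) by apply Cmod_ge_0.
  (* [M + 1] is positive without any claim that [Cexp z] is nonzero. *)
  assert (He : (0 < e / (M + 1))%R) by (apply Rdiv_lt_0_compat; [apply cond_pos|lra]).
  destruct (Cexp_remainder_0 _ He) as [d [Hd H]].
  exists (mkposreal d Hd). intros y Hy.
  change (Cmod (y - z) < d)%R in Hy.
  change (Cmod ((Cexp y - Cexp z) - (y - z) * Cexp z) <= e * Cmod (y - z))%R.
  replace (Cexp y) with (Cexp z * Cexp (y - z)) by (rewrite <- Cexp_plus; f_equal; ring).
  replace (Cexp z * Cexp (y - z) - Cexp z - (y - z) * Cexp z)
    with (Cexp z * (Cexp (y - z) - 1 - (y - z))) by ring.
  rewrite Cmod_mult. fold M. specialize (H _ Hy).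
  assert (P := Cmod_ge_0 (y - z)).
  apply Rle_trans with (M * (e / (M + 1) * Cmod (y - z)))%R.
  { now apply Rmult_le_compat_l. }
  apply Rle_trans with ((M + 1) * (e / (M + 1) * Cmod (y - z)))%R.
  { apply Rmult_le_compat_r; [|lra]. apply Rmult_le_pos; lra. }
  right; field; lra.
Qed.

Lemma is_derive_Cexp_linear (c k z : C) :
  is_derive (K := C_AbsRing) (V := C_NormedModule) (fun z : C => c * Cexp (k * z)) z (c * k * Cexp (k * z)).
Proof.
  assert (H : is_derive (K := C_AbsRing) (V := C_NormedModule) (fun z => Cexp (k * z)) z (k * Cexp (k * z))).
  { apply (is_derive_comp (K := C_AbsRing) (V := C_NormedModule) Cexp (fun z : C => k * z) z).
    - apply is_derive_Cexp.
    - evar_last.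
      + apply (is_derive_mult (K := C_AbsRing) (fun _ => k) (fun z => z)).
        * apply (is_derive_const (K := C_AbsRing) (V := AbsRing_NormedModule C_AbsRing)).
        * apply (is_derive_id (K := C_AbsRing)).
        * exact Cmult_comm.
      + change (0 * z + k * 1 = k). ring. }
  replace (c * k * Cexp (k * z)) with (c * (k * Cexp (k * z))) by ring.
  eapply filterdiff_ext_lin.
  - exact (filterdiff_scal_r_fct (K := C_AbsRing)
             (U := AbsRing_NormedModule C_AbsRing) (V := C_NormedModule) c
             (fun z => Cexp (k * z)) _ Cmult_comm H).
  - intros y. change (c * (y * (k * Cexp (k * z))) = y * (c * (k * Cexp (k * z)))). ring.
Qed.

(** * The binomial series on the unit circle *)

(** The coefficient of z^n in the expansion of (1 - z)^(-b). *)
Definition negbin (b : C) (n : nat) : C := pochhammer b n / INR (fact n).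

Lemma RtoC_INR_neq_0 (n : nat) : n <> O -> RtoC (INR n) <> 0.
Proof. intros H E. apply (not_0_INR _ H). now apply RtoC_inj. Qed.

Lemma negbin_S (b : C) (n : nat) :
  INR (S n) * negbin b (S n) = (b + INR n) * negbin b n.
Proof.
  unfold negbin. simpl pochhammer. rewrite fact_simpl, mult_INR, RtoC_mult.
  field. split; apply RtoC_INR_neq_0; [apply fact_neq_0|lia].
Qed.

(* Raabe's test: the hypothesis makes [n * r n] dominate [eps] times the remaining sum. *)
Lemma ex_series_raabe (r : nat -> R) (N : nat) (eps : R) :
  (forall n, 0 <= r n)%R -> (0 < eps)%R ->
  (forall n, (N <= n)%nat -> INR (S n) * r (S n) <= (INR n - eps) * r n)%R ->
  ex_series r.
Proof.
  intros Hr He H. apply (ex_series_incr_n r N).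
  set (s := sum_n (fun k => r (N + k)%nat)).
  (* Telescoping: each use of [H] trades a decrease of [n * r n] for one more term of [eps * s]. *)
  assert (B : forall m, (eps * s m + INR (S (N + m)) * r (S (N + m)) <= INR N * r N)%R).
  { induction m as [|m IH].
    - unfold s. rewrite sum_O, Nat.add_0_r. specialize (H N (le_n N)). lra.
    - unfold s in *. rewrite sum_Sn. unfold plus; simpl AbelianMonoid.plus.
      replace (N + S m)%nat with (S (N + m)) by lia.
      specialize (H (S (N + m)) ltac:(lia)). lra. }
  apply ex_finite_lim_seq_incr with (M := (INR N * r N / eps)%R).
  - intros n. rewrite sum_Sn. unfold plus; simpl. change (s n <= s n + r (N + S n)%nat)%R. specialize (Hr (N + S n)%nat). lra.
  - intros n. apply Rle_div_r; [exact He|]. specialize (B n).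
    assert (0 <= INR (S (N + n)) * r (S (N + n)))%R
      by (apply Rmult_le_pos; [apply pos_INR|apply Hr]).
    change (s n * eps <= INR N * r N)%R. lra.
Qed.

(** By [negbin_S] the ratio condition of Raabe's test reads |b + n| <= n - eps, which holds for
    large n with eps = - Re b / 2. *)
Lemma ex_series_Cmod_negbin (b : C) : (Re b < 0)%R ->
  ex_series (fun n => Cmod (negbin b n)).
Proof.
  destruct b as [x y]. simpl. intros Hx.
  (* Squaring |b + n| <= n + x/2 leaves y^2 + 3/4 x^2 <= - n x, whence this threshold. *)
  destruct (INR_unbounded ((y * y + 3 / 4 * (x * x)) / - x)) as [N HN].
  apply ex_series_raabe with (N := N) (eps := (- x / 2)%R).
  - intros n; apply Cmod_ge_0.
  - lra.
  - intros n Hn.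
    rewrite <- (Rabs_pos_eq (INR (S n))) by apply pos_INR.
    rewrite <- Cmod_R, <- !Cmod_mult, negbin_S, Cmod_mult.
    apply Rmult_le_compat_r; [apply Cmod_ge_0|].
    apply le_INR in Hn.
    assert (L : (y * y + 3 / 4 * (x * x) < INR n * - x)%R)
      by (apply Rlt_div_l; [lra|]; lra).
    assert (P : (- (3 / 4) * x <= INR n)%R) by nra.
    unfold Cmod. simpl.
    rewrite <- (sqrt_square (INR n - - x / 2)) by lra.
    apply sqrt_le_1_alt. nra.
Qed.

(** * Real power series up to the boundary point 1 *)

Lemma CV_radius_ge_1 (a : nat -> R) :
  ex_series (fun n => Rabs (a n)) -> Rbar_le 1 (CV_radius a).
Proof.
  intros H. apply Rbar_not_lt_le. intros L.
  apply (CV_disk_outside a 1).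
  - now rewrite Rabs_R1.
  - apply is_lim_seq_ext with a.
    + intros n. now rewrite pow1, Rmult_1_r.
    + now apply ex_series_lim_0, ex_series_Rabs.
Qed.

Lemma PSeries_1 (a : nat -> R) : PSeries a 1 = Series a.
Proof. apply Series_ext. intros n. now rewrite pow1, Rmult_1_r. Qed.

(** If the radius exceeds 1 this is plain continuity; if it equals 1 it is Abel's theorem. *)
Lemma PSeries_at_left_1 (a : nat -> R) :
  ex_series (fun n => Rabs (a n)) ->
  filterlim (PSeries a) (at_left 1) (locally (Series a)).
Proof.
  intros H. rewrite <- PSeries_1.
  destruct (Rbar_le_lt_or_eq_dec _ _ (CV_radius_ge_1 a H)) as [L|E].
  - apply (filterlim_filter_le_1 (F := locally 1%R)).
    + apply filter_le_within.
    + apply continuity_pt_filterlim, PSeries_continuity. now rewrite Rabs_R1.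
  - pose proof (Abel a) as A. rewrite <- E in A. apply A; simpl.
    + lra.
    + exact I.
    + exists (Series a). apply is_pseries_R.
      apply is_series_ext with a.
      * intros n. now rewrite pow1, Rmult_1_r.
      * now apply Series_correct, ex_series_Rabs.
Qed.

Lemma is_series_PSeries_derive (a : nat -> R) (t : R) :
  Rbar_lt (Rabs t) (CV_radius a) ->
  is_series (fun n => INR n * a n * t ^ n)%R (t * PSeries (PS_derive a) t)%R.
Proof.
  intros H. rewrite <- PSeries_incr_1.
  apply is_series_ext with (fun n => PS_incr_1 (PS_derive a) n * t ^ n)%R.
  - intros [|n]; simpl PS_incr_1; unfold PS_derive, zero; simpl; ring.
  - apply is_pseries_R, PSeries_correct, ex_pseries_incr_1, ex_pseries_derive, H.
Qed.

Lemma is_series_PSeries (a : nat -> R) (t : R) :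
  Rbar_lt (Rabs t) (CV_radius a) ->
  is_series (fun n => a n * t ^ n)%R (PSeries a t).
Proof. intros H. now apply is_pseries_R, PSeries_correct, CV_radius_inside. Qed.

(* The principal logarithm of [1 - t * w], for [0 <= t < 1] and [Cmod w = 1]. *)
Definition Clog1m (w : C) (t : R) : C :=
  (ln (1 - 2 * t * Re w + t * t) / 2, - atan (t * Im w / (1 - t * Re w)))%R.

(** The derivative - w / (1 - t w) equals (t - w) / |1 - t w|^2 because |w| = 1, and 1 - 2 t Re w +
    t^2 is that squared modulus. The condition [t * Re w < 1] keeps 1 - t w in the right half-plane,
    where [atan] gives its argument. *)
Lemma is_derive_Clog1m (w : C) (t : R) :
  (Re w * Re w + Im w * Im w = 1)%R -> (t * Re w < 1)%R ->
  (0 < 1 - 2 * t * Re w + t * t)%R ->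
  is_derive (fun t => Re (Clog1m w t)) t ((t - Re w) / (1 - 2 * t * Re w + t * t))%R /\
  is_derive (fun t => Im (Clog1m w t)) t (- Im w / (1 - 2 * t * Re w + t * t))%R.
Proof.
  destruct w as [x y]. unfold Clog1m. simpl. intros Hw H1 H2. split.
  - auto_derive; [exact H2|]. field. lra.
  - auto_derive; [lra|]. unfold Rsqr.
    assert (Q : ((1 - t * x) * (1 - t * x) + (t * y) * (t * y) = 1 - 2 * t * x + t * t)%R).
    { transitivity (1 - 2 * t * x + t * t * (x * x + y * y))%R; [ring|]. rewrite Hw; ring. }
    rewrite <- Q. field. rewrite Q. split; lra.
Qed.

(** Real and imaginary parts of (e^h g)' = e^h (g' + h' g), with h = p + i q and g = g1 + i g2. *)
Lemma is_derive_Cexp_mul (p q g1 g2 : R -> R) (t dp dq D1 D2 : R) :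
  is_derive p t dp -> is_derive q t dq -> is_derive g1 t D1 -> is_derive g2 t D2 ->
  is_derive (fun t => exp (p t) * (g1 t * cos (q t) - g2 t * sin (q t)))%R t
    (exp (p t) * ((D1 + dp * g1 t - dq * g2 t) * cos (q t)
                  - (D2 + dp * g2 t + dq * g1 t) * sin (q t)))%R /\
  is_derive (fun t => exp (p t) * (g1 t * sin (q t) + g2 t * cos (q t)))%R t
    (exp (p t) * ((D1 + dp * g1 t - dq * g2 t) * sin (q t)
                  + (D2 + dp * g2 t + dq * g1 t) * cos (q t)))%R.
Proof.
  intros Hp Hq H1 H2.
  assert (ex_derive p t) by now exists dp. assert (ex_derive q t) by now exists dq.
  assert (ex_derive g1 t) by now exists D1. assert (ex_derive g2 t) by now exists D2.
  apply is_derive_unique in Hp, Hq, H1, H2.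
  split; (auto_derive; [repeat split; assumption|]);
    change (fun x : R => p x) with p; change (fun x : R => q x) with q;
    change (fun x : R => g1 x) with g1; change (fun x : R => g2 x) with g2;
    rewrite Hp, Hq, H1, H2; ring.
Qed.

(** * Radial closed form of the binomial series *)

Section BinomialSeries.

Variables b w : C.
Hypothesis Hb : (Re b < 0)%R.
Hypothesis Hw : (Re w * Re w + Im w * Im w = 1)%R.

(** Fixing the direction [w] turns the complex series into two real power series in the radius t,
    open to real calculus. *)
Let d (n : nat) : C := negbin b n * w ^ n.
Let g1 : R -> R := PSeries (fun n => Re (d n)).
Let g2 : R -> R := PSeries (fun n => Im (d n)).

Lemma Cmod_negbin_pow (n : nat) : Cmod (d n) = Cmod (negbin b n).
Proof.
  unfold d. rewrite Cmod_mult, Cmod_pow.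
  replace (Cmod w) with 1%R.
  - now rewrite pow1, Rmult_1_r.
  - unfold Cmod. destruct w as [x y]. simpl in *.
    transitivity (sqrt 1); [now rewrite sqrt_1|].
    f_equal. lra.
Qed.

Lemma ex_series_Rabs_Re : ex_series (fun n => Rabs (Re (d n))).
Proof.
  apply (ex_series_le (K := R_AbsRing) (V := R_CompleteNormedModule)) with (2 := ex_series_Cmod_negbin b Hb).
  intros n. rewrite <- Cmod_negbin_pow.
  change (Rabs (Rabs (Re (d n))) <= Cmod (d n))%R. rewrite Rabs_Rabsolu.
  apply re_le_Cmod.
Qed.

Lemma ex_series_Rabs_Im : ex_series (fun n => Rabs (Im (d n))).
Proof.
  apply (ex_series_le (K := R_AbsRing) (V := R_CompleteNormedModule)) with (2 := ex_series_Cmod_negbin b Hb).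
  intros n. rewrite <- Cmod_negbin_pow.
  change (Rabs (Rabs (Im (d n))) <= Cmod (d n))%R. rewrite Rabs_Rabsolu.
  eapply Rle_trans; [|apply Rmax_Cmod]. apply Rmax_r.
Qed.

Lemma negbin_pow_S (n : nat) :
  INR (S n) * d (S n) = w * ((b + INR n) * d n).
Proof.
  unfold d. simpl Cpow.
  replace (INR (S n) * (negbin b (S n) * (w * w ^ n)))
    with (w * ((INR (S n) * negbin b (S n)) * w ^ n)) by ring.
  rewrite negbin_S. ring.
Qed.

Lemma is_series_negbin : is_series d (Series (fun n => Re (d n)), Series (fun n => Im (d n))).
Proof.
  assert (E : ex_series d).
  { apply (ex_series_le (K := C_AbsRing) (V := C_CompleteNormedModule)) with (2 := ex_series_Cmod_negbin b Hb).
    intros n. rewrite <- Cmod_negbin_pow. apply Rle_refl. }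
  destruct E as [l E]. pose proof (CSeries_unique d l E) as U. unfold CSeries in U.
  now rewrite U.
Qed.

Let D1 : R -> R := PSeries (PS_derive (fun n => Re (d n))).
Let D2 : R -> R := PSeries (PS_derive (fun n => Im (d n))).

Lemma radius_Re (t : R) : (0 <= t < 1)%R -> Rbar_lt (Rabs t) (CV_radius (fun n => Re (d n))).
Proof.
  intros Ht. apply Rbar_lt_le_trans with 1%R; [|apply CV_radius_ge_1, ex_series_Rabs_Re].
  simpl. rewrite Rabs_pos_eq; lra.
Qed.

Lemma radius_Im (t : R) : (0 <= t < 1)%R -> Rbar_lt (Rabs t) (CV_radius (fun n => Im (d n))).
Proof.
  intros Ht. apply Rbar_lt_le_trans with 1%R; [|apply CV_radius_ge_1, ex_series_Rabs_Im].
  simpl. rewrite Rabs_pos_eq; lra.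
Qed.

(** Here P1 + i P2 = t g' + b g, so the claim is g' = w (t g' + b g), that is (1 - t w) g' = b w g.
    It is the recurrence [negbin_pow_S] summed against t^n. *)
Lemma negbin_ode (t : R) : (0 <= t < 1)%R ->
  let P1 := (t * D1 t + (Re b * g1 t - Im b * g2 t))%R in
  let P2 := (t * D2 t + (Re b * g2 t + Im b * g1 t))%R in
  (D1 t = Re w * P1 - Im w * P2 /\ D2 t = Re w * P2 + Im w * P1)%R.
Proof.
  intros Ht.
  pose proof (is_series_PSeries_derive _ _ (radius_Re t Ht)) as A1.
  pose proof (is_series_PSeries_derive _ _ (radius_Im t Ht)) as A2.
  pose proof (is_series_PSeries _ _ (radius_Re t Ht)) as B1.
  pose proof (is_series_PSeries _ _ (radius_Im t Ht)) as B2.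
  fold D1 in A1. fold D2 in A2. fold g1 in B1. fold g2 in B2.
  assert (LC : forall u1 u2 u3 u4 c1 c2 c3 c4 l1 l2 l3 l4,
    is_series u1 l1 -> is_series u2 l2 -> is_series u3 l3 -> is_series u4 l4 ->
    is_series (fun n => c1 * u1 n + (c2 * u2 n + (c3 * u3 n + c4 * u4 n)))%R
      (c1 * l1 + (c2 * l2 + (c3 * l3 + c4 * l4)))%R).
  { intros.
    repeat apply (is_series_plus (K := R_AbsRing) (V := R_NormedModule));
    now apply (is_series_scal_l (K := R_AbsRing) (V := R_NormedModule)). }
  assert (Rec : forall n,
    (INR (S n) * Re (d (S n)) = Re w * (INR n * Re (d n) + (Re b * Re (d n) - Im b * Im (d n)))
      - Im w * (INR n * Im (d n) + (Re b * Im (d n) + Im b * Re (d n))) /\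
    INR (S n) * Im (d (S n)) = Re w * (INR n * Im (d n) + (Re b * Im (d n) + Im b * Re (d n)))
      + Im w * (INR n * Re (d n) + (Re b * Re (d n) - Im b * Im (d n))))%R).
  { intros n. pose proof (negbin_pow_S n) as E.
    destruct (d (S n)) as [p q], (d n) as [p' q'], b as [b1 b2], w as [x y].
    pose proof (f_equal Re E) as E1. pose proof (f_equal Im E) as E2.
    unfold Cmult, Cplus, RtoC, Re, Im, fst, snd in *. split; lra. }
  split.
  - unfold D1 at 1, PSeries. apply is_series_unique.
    specialize (LC _ _ _ _ (Re w) (- Im w)%R (Re w * Re b - Im w * Im b)%R
      (- Re w * Im b - Im w * Re b)%R _ _ _ _ A1 A2 B1 B2).
    evar_last; [eapply is_series_ext; [|exact LC]|].
    + intros n. unfold PS_derive. rewrite (proj1 (Rec n)).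
      match goal with |- ?l = ?r => change (@eq R l r) end. ring.
    + ring.
  - unfold D2 at 1, PSeries. apply is_series_unique.
    specialize (LC _ _ _ _ (Im w) (Re w)%R (Re w * Im b + Im w * Re b)%R
      (Re w * Re b - Im w * Im b)%R _ _ _ _ A1 A2 B1 B2).
    evar_last; [eapply is_series_ext; [|exact LC]|].
    + intros n. unfold PS_derive. rewrite (proj2 (Rec n)).
      match goal with |- ?l = ?r => change (@eq R l r) end. ring.
    + ring.
Qed.


Lemma Clog1m_arg_pos (t : R) : (0 <= t < 1)%R ->
  (t * Re w < 1 /\ 0 < 1 - 2 * t * Re w + t * t)%R.
Proof. intros Ht. assert (Re w <= 1)%R by nra. split; nra. Qed.

(* With [g = (g1, g2)], both [g] and [(1 - t w)^(-b)] solve [(1 - t w) g' = b w g], so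
   [g(t) * exp (b * log (1 - t w))] has zero derivative. *)
Lemma negbin_closed_form (t : R) : (0 <= t < 1)%R ->
  (g1 t, g2 t) = Cexp (- b * Clog1m w t).
Proof.
  intros Ht.
  (* p + i q = b log(1 - t w), the exponent of the integrating factor. *)
  set (p := fun t => (Re b * Re (Clog1m w t) - Im b * Im (Clog1m w t))%R).
  set (q := fun t => (Re b * Im (Clog1m w t) + Im b * Re (Clog1m w t))%R).
  assert (D : forall s, (0 <= s <= t)%R ->
    is_derive (fun t => exp (p t) * (g1 t * cos (q t) - g2 t * sin (q t)))%R s 0%R /\
    is_derive (fun t => exp (p t) * (g1 t * sin (q t) + g2 t * cos (q t)))%R s 0%R).
  { intros s Hs. assert (Hs1 : (0 <= s < 1)%R) by lra.
    destruct (Clog1m_arg_pos s Hs1) as [P1 P2].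
    destruct (is_derive_Clog1m w s Hw P1 P2) as [L1 L2].
    pose proof (is_derive_PSeries _ _ (radius_Re s Hs1)) as G1.
    pose proof (is_derive_PSeries _ _ (radius_Im s Hs1)) as G2.
    fold g1 in G1. fold g2 in G2.
    change (is_derive g1 s (D1 s)) in G1. change (is_derive g2 s (D2 s)) in G2.
    set (l1 := ((s - Re w) / (1 - 2 * s * Re w + s * s))%R) in *.
    set (l2 := (- Im w / (1 - 2 * s * Re w + s * s))%R) in *.
    assert (Hp : is_derive p s (Re b * l1 - Im b * l2)%R).
    { apply (is_derive_minus (K := R_AbsRing) (V := R_NormedModule)); now apply is_derive_scal. }
    assert (Hq : is_derive q s (Re b * l2 + Im b * l1)%R).
    { apply (is_derive_plus (K := R_AbsRing) (V := R_NormedModule)); now apply is_derive_scal. }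
    destruct (negbin_ode s Hs1) as [O1 O2].
    (* The two parts of g' + b L' g = 0, where L = log(1 - s w) and L' = l1 + i l2. *)
    assert (Z : (D1 s + (Re b * l1 - Im b * l2) * g1 s - (Re b * l2 + Im b * l1) * g2 s = 0 /\
                 D2 s + (Re b * l1 - Im b * l2) * g2 s + (Re b * l2 + Im b * l1) * g1 s = 0)%R).
    { set (Q := (1 - 2 * s * Re w + s * s)%R) in *.
      set (e1 := (Re b * g1 s - Im b * g2 s)%R) in *.
      set (e2 := (Re b * g2 s + Im b * g1 s)%R) in *.
      set (x := Re w) in *. set (y := Im w) in *.
      assert (O1' : (D1 s - (x * (s * D1 s + e1) - y * (s * D2 s + e2)) = 0)%R) by lra.
      assert (O2' : (D2 s - (x * (s * D2 s + e2) + y * (s * D1 s + e1)) = 0)%R) by lra.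
      assert (N : (x * x + y * y - 1 = 0)%R) by lra.
      (* Multiplying (1 - s w) g' = w e by the conjugate 1 - s conj(w) gives Q g' = (w - s) e, with
         e = b g. The coefficients below are the parts of that factor; the multiples of [N] replace
         |w|^2 by 1. *)
      assert (F1 : (Q * D1 s = (x - s) * e1 - y * e2)%R).
      { apply Rminus_diag_uniq.
        match type of O1' with ?o1 = _ => match type of O2' with ?o2 = _ =>
        match type of N with ?n = _ =>
          transitivity ((1 - s * x) * o1 - s * y * o2 - s * s * D1 s * n - s * e1 * n)%R
        end end end; [unfold Q; ring|]. rewrite O1', O2', N; ring. }
      assert (F2 : (Q * D2 s = (x - s) * e2 + y * e1)%R).
      { apply Rminus_diag_uniq.
        match type of O1' with ?o1 = _ => match type of O2' with ?o2 = _ =>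
        match type of N with ?n = _ =>
          transitivity ((1 - s * x) * o2 + s * y * o1 - s * s * D2 s * n - s * e2 * n)%R
        end end end; [unfold Q; ring|]. rewrite O1', O2', N; ring. }
      split; apply (Rmult_eq_reg_l Q); try lra.
      - transitivity (Q * D1 s + (s - x) * e1 + y * e2)%R;
          [unfold l1, l2, e1, e2; field; lra|]. rewrite F1; ring.
      - transitivity (Q * D2 s + (s - x) * e2 - y * e1)%R;
          [unfold l1, l2, e1, e2; field; lra|]. rewrite F2; ring. }
    destruct Z as [Z1 Z2].
    destruct (is_derive_Cexp_mul p q g1 g2 s _ _ _ _ Hp Hq G1 G2) as [K1 K2].
    rewrite Z1, Z2 in K1, K2. split.
    - evar_last; [exact K1|]. ring.
    - evar_last; [exact K2|]. ring. }
  assert (I0 : Clog1m w 0 = 0).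
  { unfold Clog1m. replace (1 - 2 * 0 * Re w + 0 * 0)%R with 1%R by ring.
    rewrite ln_1. replace (0 * Im w / (1 - 0 * Re w))%R with 0%R by (field; lra).
    rewrite atan_0. apply injective_projections; simpl; field. }
  assert (J : forall f : nat -> R, PSeries f 0 = f O).
  { intros f. apply PSeries_0. }
  assert (d0 : d 0 = 1).
  { unfold d, negbin. simpl. field. }
  assert (K : Cexp (b * Clog1m w t) * (g1 t, g2 t) = 1).
  { destruct (Req_dec t 0) as [->|Nt].
    - rewrite I0, Cmult_0_r, Cexp_0. unfold g1, g2. rewrite !J, d0.
      apply injective_projections; simpl; ring.
    - assert (E1 := eq_is_derive (V := R_NormedModule) _ 0 t (fun s Hs => proj1 (D s Hs)) ltac:(lra)).
      assert (E2 := eq_is_derive (V := R_NormedModule) _ 0 t (fun s Hs => proj2 (D s Hs)) ltac:(lra)).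
      cbv beta in E1, E2.
      assert (p0 : p 0 = 0%R) by (unfold p; rewrite I0; simpl; ring).
      assert (q0 : q 0 = 0%R) by (unfold q; rewrite I0; simpl; ring).
      assert (g10 : g1 0 = 1%R) by (unfold g1; now rewrite J, d0).
      assert (g20 : g2 0 = 0%R) by (unfold g2; now rewrite J, d0).
      rewrite p0, q0, g10, g20, exp_0, cos_0, sin_0 in E1, E2.
      apply injective_projections.
      + change (exp (p t) * cos (q t) * g1 t - exp (p t) * sin (q t) * g2 t = 1)%R. lra.
      + change (exp (p t) * cos (q t) * g2 t + exp (p t) * sin (q t) * g1 t = 0)%R. lra. }
  replace (- b * Clog1m w t) with (- (b * Clog1m w t)) by ring.
  transitivity (Cexp (- (b * Clog1m w t)) * (Cexp (b * Clog1m w t) * (g1 t, g2 t))).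
  - rewrite Cmult_assoc, <- Cexp_plus.
    replace (- (b * Clog1m w t) + b * Clog1m w t) with (RtoC 0) by ring.
    now rewrite Cexp_0, Cmult_1_l.
  - now rewrite K, Cmult_1_r.
Qed.

(** [PSeries_at_left_1] makes each part of the sum a limit as t tends to 1 from the left, so
    uniqueness of limits identifies it with that of the closed form. *)
Lemma is_series_negbin_of_lim (l : C) :
  filterlim (fun t => Re (Cexp (- b * Clog1m w t))) (at_left 1) (locally (Re l)) ->
  filterlim (fun t => Im (Cexp (- b * Clog1m w t))) (at_left 1) (locally (Im l)) ->
  is_series d l.
Proof.
  intros H1 H2.
  assert (N : at_left 1 (fun t => 0 <= t < 1)%R).
  { exists (mkposreal 1 Rlt_0_1). intros y B Hy.
    change (Rabs (y - 1) < 1)%R in B. apply Rabs_def2 in B. lra. }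
  assert (A1 : Series (fun n => Re (d n)) = Re l).
  { apply (filterlim_locally_unique (F := at_left 1) (K := R_AbsRing) (V := R_NormedModule) g1).
    - apply PSeries_at_left_1, ex_series_Rabs_Re.
    - eapply filterlim_ext_loc; [|exact H1].
      apply filter_imp with (2 := N). intros t Ht.
      now rewrite <- negbin_closed_form. }
  assert (A2 : Series (fun n => Im (d n)) = Im l).
  { apply (filterlim_locally_unique (F := at_left 1) (K := R_AbsRing) (V := R_NormedModule) g2).
    - apply PSeries_at_left_1, ex_series_Rabs_Im.
    - eapply filterlim_ext_loc; [|exact H2].
      apply filter_imp with (2 := N). intros t Ht.
      now rewrite <- negbin_closed_form. }
  rewrite (surjective_pairing l).
  change (is_series d (Re l, Im l)). rewrite <- A1, <- A2.
  apply is_series_negbin.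
Qed.

End BinomialSeries.

(** For w other than 1 the logarithm is still differentiable at t = 1, so the radial limit is the
    value there. *)
Lemma is_series_negbin_unit (b w : C) :
  (Re b < 0)%R -> (Re w * Re w + Im w * Im w = 1)%R -> (Re w < 1)%R ->
  is_series (fun n => negbin b n * w ^ n) (Cexp (- b * Clog1m w 1)).
Proof.
  intros Hb Hw Hw1.
  destruct (is_derive_Clog1m w 1 Hw) as [L1 L2]; try lra.
  apply ex_intro in L1, L2.
  set (l1 := fun t => Re (Clog1m w t)) in L1. set (l2 := fun t => Im (Clog1m w t)) in L2.
  apply is_series_negbin_of_lim; trivial;
    (eapply filterlim_filter_le_1; [apply filter_le_within|]).
  - change (continuous (fun t => exp (- Re b * l1 t - - Im b * l2 t)
      * cos (- Re b * l2 t + - Im b * l1 t))%R 1%R).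
    apply (ex_derive_continuous (K := R_AbsRing) (V := R_NormedModule)).
    auto_derive; repeat split; assumption.
  - change (continuous (fun t => exp (- Re b * l1 t - - Im b * l2 t)
      * sin (- Re b * l2 t + - Im b * l1 t))%R 1%R).
    apply (ex_derive_continuous (K := R_AbsRing) (V := R_NormedModule)).
    auto_derive; repeat split; assumption.
Qed.

(** At w = 1 the logarithm blows up, but the closed form has modulus (1 - t)^(- Re b), which tends
    to 0 since Re b < 0. *)
Lemma is_series_negbin_1 (b : C) :
  (Re b < 0)%R -> is_series (fun n => negbin b n * 1 ^ n) (RtoC 0).
Proof.
  intros Hb.
  assert (Z : forall f : R -> R,
    (forall t, (t < 1)%R -> (Rabs (f t) <= exp (- Re b * ln (1 - t)))%R) ->
    filterlim f (at_left 1) (locally 0%R)).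
  { intros f Hf P [e He]. 
    (* The radius is the solution s of s^(- Re b) = e. *)
    assert (Hd : (0 < exp (ln e / - Re b))%R) by apply exp_pos.
    exists (mkposreal _ Hd). intros t Bt Ht. apply He.
    change (Rabs (t - 1) < exp (ln e / - Re b))%R in Bt.
    change (Rabs (f t - 0) < e)%R. rewrite Rminus_0_r.
    eapply Rle_lt_trans; [apply Hf, Ht|].
    rewrite Rabs_left in Bt by lra.
    rewrite <- (exp_ln e) at 1 by apply cond_pos. apply exp_increasing.
    rewrite Rmult_comm. apply Rlt_div_r; [lra|].
    apply Rlt_le_trans with (ln (exp (ln e / - Re b))).
    - apply ln_increasing; lra.
    - rewrite ln_exp. right; field; lra. }
  assert (E : forall t, (t < 1)%R ->
    exp (Re (- b * Clog1m 1 t)) = exp (- Re b * ln (1 - t))%R).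
  { intros t Ht. f_equal.
    replace (Clog1m 1 t) with (RtoC (ln (1 - t))); [unfold Re; simpl; ring|].
    unfold Clog1m; simpl.
    replace (1 - 2 * t * 1 + t * t)%R with ((1 - t) * (1 - t))%R by ring.
    rewrite ln_mult by lra.
    replace (t * 0 / (1 - t * 1))%R with 0%R by (field; lra).
    rewrite atan_0. apply injective_projections; simpl; field. }
  apply is_series_negbin_of_lim; [exact Hb|simpl; ring| |];
    apply Z; intros t Ht; rewrite <- E by exact Ht; apply Rabs_Cexp_le.
Qed.

(** * Trisection of the binomial series *)

Lemma pochhammer_S (a : C) (n : nat) :
  pochhammer a (S n) = pochhammer a n * (a + INR n).
Proof. reflexivity. Qed.

Lemma pochhammer_1 (n : nat) : pochhammer 1 n = INR (fact n).
Proof.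
  induction n as [|n IH]; [reflexivity|].
  rewrite fact_simpl, mult_INR, RtoC_mult, S_INR, RtoC_plus.
  simpl. rewrite IH. ring.
Qed.

(** The three factors 3a + 3j, 3a + 3j + 1, 3a + 3j + 2 added at each step are 3 times a + j, a +
    1/3 + j, a + 2/3 + j. *)
Lemma pochhammer_triplication (a : C) (j : nat) :
  pochhammer (3 * a) (3 * j) = 27 ^ j *
    (pochhammer a j * pochhammer (a + (1 / 3)%R) j * pochhammer (a + (2 / 3)%R) j).
Proof.
  induction j as [|j IH].
  - simpl. ring.
  - replace (3 * S j)%nat with (S (S (S (3 * j)))) by lia.
    rewrite !pochhammer_S, IH, !S_INR, mult_INR, !RtoC_plus, RtoC_mult.
    rewrite INR_IZR_INZ. simpl IZR. simpl Cpow.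
    rewrite !RtoC_div by lra. field.
Qed.

Lemma hyp3F2_term_negbin (a : C) (j : nat) :
  hyp3F2_term a (a + (1 / 3)%R) (a + (2 / 3)%R) (1 / 3)%R (2 / 3)%R 1 j
  = negbin (3 * a) (3 * j).
Proof.
  unfold hyp3F2_term, negbin. rewrite Cpow_1_l, Cmult_1_r.
  rewrite <- (pochhammer_1 (3 * j)), pochhammer_triplication.
  (* Triplication at a = 1/3 shows that the denominator is (3j)! / 27^j, so the powers of 27
     cancel. *)
  assert (E : pochhammer 1 (3 * j) = 27 ^ j *
    (pochhammer (1 / 3)%R j * pochhammer (2 / 3)%R j * INR (fact j))).
  { replace (RtoC 1) with (3 * (1 / 3)%R) at 1
      by (rewrite <- RtoC_mult; f_equal; field).
    rewrite pochhammer_triplication.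
    replace (RtoC (1 / 3) + RtoC (1 / 3)) with (RtoC (2 / 3))
      by (rewrite <- RtoC_plus; f_equal; field).
    replace (RtoC (1 / 3) + RtoC (2 / 3)) with (RtoC 1)
      by (rewrite <- RtoC_plus; f_equal; field).
    rewrite pochhammer_1. ring. }
  assert (N : pochhammer 1 (3 * j) <> 0)
    by (rewrite pochhammer_1; apply RtoC_INR_neq_0, fact_neq_0).
  rewrite E in N |- *.
  (* Each factor is nonzero because the whole product is (3j)!. *)
  field. repeat split; intros H; apply N; rewrite H; ring.
Qed.

Definition omega : C := (- (1 / 2), sqrt 3 / 2)%R.
Definition omega' : C := (- (1 / 2), - (sqrt 3 / 2))%R.

Lemma sqrt_3_sq : (sqrt 3 * sqrt 3 = 3)%R.
Proof. apply sqrt_sqrt; lra. Qed.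

Lemma omega_cube : omega ^ 3 = 1 /\ omega' ^ 3 = 1.
Proof.
  pose proof sqrt_3_sq as S3.
  assert (sqrt 3 * sqrt 3 * sqrt 3 = 3 * sqrt 3)%R by now rewrite S3.
  split; apply injective_projections; unfold omega, omega'; simpl; lra.
Qed.

Lemma omega_sum : 1 + omega + omega' = 0 /\ 1 + omega ^ 2 + omega' ^ 2 = 0.
Proof.
  pose proof sqrt_3_sq.
  split; apply injective_projections; unfold omega, omega'; simpl; nra.
Qed.

Lemma atan_PI6 : atan (sqrt 3 / 3) = (PI / 6)%R.
Proof.
  pose proof PI_RGT_0. pose proof sqrt_3_sq.
  assert (0 < sqrt 3)%R by (apply sqrt_lt_R0; lra).
  rewrite <- (atan_tan (PI / 6)) by lra. f_equal. rewrite tan_PI6.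
  apply (Rmult_eq_reg_r (3 * sqrt 3)); [|lra]. field_simplify; try lra.
Qed.

(** 1 - omega = 3/2 - i sqrt 3 / 2 has modulus sqrt 3 and argument - PI/6; [omega'] is the
    conjugate. *)
Lemma Clog1m_omega :
  Clog1m omega 1 = (ln 3 / 2, - (PI / 6))%R /\ Clog1m omega' 1 = (ln 3 / 2, PI / 6)%R.
Proof.
  unfold Clog1m, omega, omega'; simpl.
  replace (1 - 2 * 1 * - (1 / 2) + 1 * 1)%R with 3%R by field.
  replace (1 * (sqrt 3 / 2) / (1 - 1 * - (1 / 2)))%R with (sqrt 3 / 3)%R by field.
  replace (1 * - (sqrt 3 / 2) / (1 - 1 * - (1 / 2)))%R with (- (sqrt 3 / 3))%R by field.
  rewrite atan_opp, atan_PI6, Ropp_involutive. auto.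
Qed.

Definition trisect (b : C) (n : nat) : C :=
  / 3 * (negbin b n * 1 ^ n + (negbin b n * omega ^ n + negbin b n * omega' ^ n)).

Lemma Cpow_add_3mul (w : C) (j k : nat) : w ^ 3 = 1 -> w ^ (3 * j + k) = w ^ k.
Proof. intros H. rewrite Cpow_add_r, Cpow_mult_r, H, Cpow_1_l. ring. Qed.

(** The sum 1 + omega^k + omega'^k is 3 when 3 divides k and 0 otherwise. *)
Lemma trisect_mod3 (b : C) (j : nat) :
  trisect b (3 * j) = negbin b (3 * j) /\
  trisect b (S (3 * j)) = 0 /\ trisect b (S (S (3 * j))) = 0.
Proof.
  destruct omega_cube as [W W']. destruct omega_sum as [S1 S2].
  assert (E : forall k, trisect b (3 * j + k)
    = / 3 * negbin b (3 * j + k) * (1 + omega ^ k + omega' ^ k)).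
  { intros k. unfold trisect. rewrite Cpow_1_l, !Cpow_add_3mul by assumption. ring. }
  pose proof (E 0%nat) as E0. pose proof (E 1%nat) as E1. pose proof (E 2%nat) as E2.
  rewrite Nat.add_0_r in E0. rewrite Nat.add_1_r in E1.
  replace (3 * j + 2)%nat with (S (S (3 * j))) in E2 by lia.
  rewrite E0, E1, E2. repeat split.
  - simpl Cpow. field.
  - simpl Cpow. rewrite !Cmult_1_r, S1. ring.
  - rewrite S2. ring.
Qed.

(** For sgn = 1 and -1, the exponents k1 and k2; each is -3 times the logarithm of 1 - w at a
    primitive cube root w. *)
Definition root_exponent (sgn : R) : C := (- (3 / 2) * ln 3, sgn * (PI / 2))%R.

Definition u_closed (a : C) : C :=
  / 3 * Cexp (root_exponent 1 * a) + / 3 * Cexp (root_exponent (-1) * a).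

Lemma is_series_trisect (a : C) : (Re a < 0)%R -> is_series (trisect (3 * a)) (u_closed a).
Proof.
  intros Ha. assert (Hb : (Re (3 * a) < 0)%R) by (destruct a; simpl in *; lra).
  pose proof sqrt_3_sq as S3.
  assert (H1 := is_series_negbin_1 _ Hb).
  assert (H2 := is_series_negbin_unit (3 * a) omega Hb ltac:(simpl; nra) ltac:(simpl; lra)).
  assert (H3 := is_series_negbin_unit (3 * a) omega' Hb ltac:(simpl; nra) ltac:(simpl; lra)).
  destruct Clog1m_omega as [L2 L3]. rewrite L2 in H2. rewrite L3 in H3.
  pose proof (is_series_scal_l (K := C_AbsRing) (V := C_NormedModule) (/ 3) _ _
    (is_series_plus _ _ _ _ H1 (is_series_plus _ _ _ _ H2 H3))) as H.
  evar_last; [exact H|].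
  unfold u_closed.
  replace (root_exponent 1 * a) with (- (3 * a) * (ln 3 / 2, - (PI / 6))%R)
    by (destruct a; apply injective_projections; simpl; field).
  replace (root_exponent (-1) * a) with (- (3 * a) * (ln 3 / 2, PI / 6)%R)
    by (destruct a; apply injective_projections; simpl; field).
  match goal with |- scal _ (plus _ (plus ?p ?q)) = _ => change (/ 3 * (0 + (p + q)) = / 3 * p + / 3 * q) end.
  ring.
Qed.

(** [sum_n] includes its upper index, so stopping at 3j catches exactly the surviving indices 0, 3,
    ..., 3j. The hypergeometric partial sums are thus a subsequence of the trisected ones. *)
Lemma sum_n_trisect (b : C) (j : nat) :
  sum_n (trisect b) (3 * j) = sum_n (fun j => negbin b (3 * j)) j.
Proof.
  induction j as [|j IH].
  - simpl Nat.mul. rewrite !sum_O. apply (trisect_mod3 b 0).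
  - replace (3 * S j)%nat with (S (S (S (3 * j)))) by lia.
    rewrite !sum_Sn, IH.
    destruct (trisect_mod3 b j) as [_ [-> ->]].
    replace (S (S (S (3 * j)))) with (3 * S j)%nat by lia.
    destruct (trisect_mod3 b (S j)) as [-> _].
    match goal with |- plus (plus (plus ?p _) _) ?q = _ => change (p + 0 + 0 + q = p + q) end.
    ring.
Qed.

Lemma is_series_hyp3F2 (a : C) : (Re a < 0)%R ->
  is_series (hyp3F2_term a (a + (1 / 3)%R) (a + (2 / 3)%R) (1 / 3)%R (2 / 3)%R 1) (u_closed a).
Proof.
  intros Ha. apply is_series_ext with (fun j => negbin (3 * a) (3 * j)).
  { intros j. symmetry. apply hyp3F2_term_negbin. }
  unfold is_series.
  apply filterlim_ext with (fun j => sum_n (trisect (3 * a)) (3 * j)).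
  { apply sum_n_trisect. }
  eapply filterlim_comp; [|apply (is_series_trisect a Ha)].
  apply eventually_subseq. intros n; lia.
Qed.

Lemma u_eq_closed (a : C) : (Re a < 0)%R -> u a = u_closed a.
Proof. intros Ha. apply CSeries_unique, is_series_hyp3F2, Ha. Qed.

(** * The differential equation *)

Lemma is_derive_Cexp_pair (c1 c2 k1 k2 a : C) :
  is_derive (K := C_AbsRing) (V := C_NormedModule)
    (fun a : C => c1 * Cexp (k1 * a) + c2 * Cexp (k2 * a)) a
    (c1 * k1 * Cexp (k1 * a) + c2 * k2 * Cexp (k2 * a)).
Proof.
  apply (is_derive_plus (K := C_AbsRing) (V := C_NormedModule)
    (fun a : C => c1 * Cexp (k1 * a)) (fun a : C => c2 * Cexp (k2 * a)));
  apply is_derive_Cexp_linear.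
Qed.

(** Openness of the half-plane lets [u] be differentiated through its closed form, which is known
    only there. *)
Lemma locally_Re_neg (a : C) : (Re a < 0)%R ->
  locally (T := AbsRing_UniformSpace C_AbsRing) a (fun z => Re z < 0)%R.
Proof.
  intros Ha. assert (P : (0 < - Re a)%R) by lra.
  exists (mkposreal _ P). intros z Hz.
  change (Cmod (z - a) < - Re a)%R in Hz.
  pose proof (re_le_Cmod (z - a)) as M. pose proof (Rle_abs (Re (z - a))) as L.
  destruct z, a. simpl in *. lra.
Qed.

(** [CSeries] and [C_derive] are total functions; convergence and the two differentiability claims
    give the equation its intended meaning. *)
Theorem proposition5 :
  forall a : C, (Re a < 0)%R ->
    ex_series (hyp3F2_term a (a + (1 / 3)%R) (a + (2 / 3)%R) (1 / 3)%R (2 / 3)%R 1)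
    /\ ex_derive u a
    /\ ex_derive (C_derive u) a
    /\ C_derive (C_derive u) a + 3 * ln 3 * C_derive u a
       + (1 / 4 * (PI ^ 2 + ln 27 ^ 2))%R * u a = 0.
Proof.
  intros a Ha.
  set (k1 := root_exponent 1). set (k2 := root_exponent (-1)).
  set (u' := fun a => / 3 * k1 * Cexp (k1 * a) + / 3 * k2 * Cexp (k2 * a)).
  set (u'' := fun a => / 3 * k1 * k1 * Cexp (k1 * a) + / 3 * k2 * k2 * Cexp (k2 * a)).
  assert (D1 : forall z, (Re z < 0)%R ->
    is_derive (K := C_AbsRing) (V := C_NormedModule) u z (u' z)).
  { intros z Hz.
    eapply is_derive_ext_loc; [|apply (is_derive_Cexp_pair (/ 3) (/ 3) k1 k2)].
    apply filter_imp with (2 := locally_Re_neg z Hz).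
    intros y Hy. symmetry. now apply u_eq_closed. }
  (* The second derivative needs [C_derive u] on a neighbourhood of [a], hence [D1] for all z in the
     half-plane. *)
  assert (D2 : is_derive (K := C_AbsRing) (V := C_NormedModule) (C_derive u) a (u'' a)).
  { eapply is_derive_ext_loc;
      [|apply (is_derive_Cexp_pair (/ 3 * k1) (/ 3 * k2) k1 k2)].
    apply filter_imp with (2 := locally_Re_neg a Ha).
    intros y Hy. symmetry. now apply is_C_derive_unique, D1. }
  repeat split.
  - eexists; apply is_series_hyp3F2, Ha.
  - eexists; apply D1, Ha.
  - eexists; apply D2.
  - rewrite (is_C_derive_unique _ _ _ D2), (is_C_derive_unique _ _ _ (D1 a Ha)),
      (u_eq_closed a Ha).
    assert (L27 : ln 27 = (3 * ln 3)%R).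
    { replace 27%R with (3 * (3 * 3))%R by ring. rewrite !ln_mult by lra. ring. }
    rewrite L27. set (q := RtoC (1 / 4 * (PI ^ 2 + (3 * ln 3) ^ 2))%R).
    (* Both exponents satisfy the characteristic equation, so each exponential solves the
       differential equation separately. *)
    assert (C1 : k1 * k1 + 3 * ln 3 * k1 + q = 0)
      by (apply injective_projections; simpl; field).
    assert (C2 : k2 * k2 + 3 * ln 3 * k2 + q = 0)
      by (apply injective_projections; simpl; field).
    unfold u'', u', u_closed. fold k1 k2.
    transitivity (/ 3 * (k1 * k1 + 3 * ln 3 * k1 + q) * Cexp (k1 * a)
                  + / 3 * (k2 * k2 + 3 * ln 3 * k2 + q) * Cexp (k2 * a)); [ring|].
    rewrite C1, C2. ring.
Qed.
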